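(* Let $R$ be a Noetherian standard $\mathbb{N}_0^d$-graded $A$-algebra, where $A$ is the degree $(0,\ldots,0)$ component of $R$, and let $M$ be a multigraded $R$-module. Set $L:=H^0_{R_+}(M)$ and $L':=(0:_M R_+)$. Assume that $\operatorname{Ass}_A(M)$ is finite. Consider the following statements: (i) There exists $k\in \mathbb{Z}^d$ such that $\operatorname{Ass}_A(L'_n) = \operatorname{Ass}_A(L'_k)$ for all $n\in \mathbb{Z}^d$ with $n\geq k$. (ii) There exists $l \in \mathbb{Z}^d$ such that $\operatorname{Ass}_A(L_n) = \operatorname{Ass}_A(L_l)$ for all $n\in \mathbb{Z}^d$ with $n\geq l$. (iii) There exists $h\in \mathbb{Z}^d$ such that $\operatorname{Ass}_A(M_n) = \operatorname{Ass}_A(M_h)$ for all $n\in \mathbb{Z}^d$ with $n\geq h$. Then (i) implies (ii), and (ii) implies (iii).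
   Context: $\mathbb{N}_0$ denotes the non-negative integers; for $n,m\in\mathbb{Z}^d$, $n\geq m$ means $n_i\geq m_i$ for all $1\le i\le d$. All rings are commutative with identity. A Noetherian standard $\mathbb{N}_0^d$-graded $A$-algebra $R=\bigoplus_{n\in\mathbb{N}_0^d}R_n$ is a Noetherian $\mathbb{N}_0^d$-graded ring with $R_{(0,\ldots,0)}=A$, generated as an $A$-algebra by elements of total degree one. $R_+$ denotes the ideal of $R$ generated by $R_{(1,\ldots,1)}$. A multigraded $R$-module means a $\mathbb{Z}^d$-graded $R$-module $M=\bigoplus_{n\in\mathbb{Z}^d}M_n$ such that (i) each $M_n$ is a finitely generated $A$-module, and (ii) there exists $a\in\mathbb{Z}^d$ with $M_n=0$ for $n\leq a$. ($M$ is not assumed finitely generated over $R$.) Here $H^0_{R_+}(M)=\{x\in M: R_+^t x=0 \text{ for some } t\ge 1\}$ and $(0:_M R_+)=\{x\in M: R_+x=0\}$; both are graded submodules of $M$, and $L_n$, $L'_n$ denote their degree $n$ components. *)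

(* Defs.v *)
From HB Require Import structures.
From mathcomp Require Import all_boot all_order all_algebra.
From mathcomp Require Import boolp classical_sets functions cardinality fsbigop.

Set Implicit Arguments.
Unset Strict Implicit.
Unset Printing Implicit Defensive.

Import Order.TTheory GRing.Theory Num.Theory.
Local Open Scope classical_set_scope.
Local Open Scope ring_scope.

(* Commutative rings are [comPzRingType]s, so that the zero ring is allowed. *)

Definition restr_scalars (A R : pzRingType) (f : {rmorphism A -> R})
  (M : lmodType R) : Type := M.

Section RestrScalars.
Variables (A R : pzRingType) (f : {rmorphism A -> R}) (M : lmodType R).
Local Notation V := (restr_scalars f M).

HB.instance Definition _ := GRing.Zmodule.on V.

Definition restr_scale (a : A) (x : V) : V := f a *: (x : M).

Fact restr_scaleA a b x : restr_scale a (restr_scale b x) = restr_scale (a * b) x.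
Proof. by rewrite /restr_scale scalerA -rmorphM. Qed.

Fact restr_scale1 : left_id 1 restr_scale.
Proof. by move=> x; rewrite /restr_scale rmorph1 scale1r. Qed.

Fact restr_scaleDr : right_distributive restr_scale +%R.
Proof. by move=> a x y; apply: scalerDr. Qed.

Fact restr_scaleDl x : {morph restr_scale^~ x : a b / a + b}.
Proof. by move=> a b; rewrite /restr_scale rmorphD scalerDl. Qed.

HB.instance Definition _ := GRing.Zmodule_isLmodule.Build A V
  restr_scaleA restr_scale1 restr_scaleDr restr_scaleDl.
End RestrScalars.

Section Submodules.
Variables (R : pzRingType) (V : lmodType R).

Definition submodule (N : set V) : Prop := GRing.submod_closed (mem N).

Definition submodule_gen (S : set V) : set V := smallest submodule S.

Definition fin_gen (N : set V) : Prop :=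
  exists2 S : set V, finite_set S & N = submodule_gen S.

Definition ann (x : V) : set R := [set a | a *: x = 0].
End Submodules.

Section Ideals.
Variable R : comPzRingType.

Definition ideal (I : set R) : Prop := @submodule R R^o I.

Definition ideal_gen (S : set R) : set R := @submodule_gen R R^o S.

Definition ideal_mul (I J : set R) : set R :=
  ideal_gen [set x * y | x in I & y in J].

Definition ideal_exp (I : set R) (t : nat) : set R :=
  iter t (ideal_mul I) setT.

Definition prime_ideal (P : set R) : Prop :=
  [/\ ideal P, ~ P 1 & forall a b, P (a * b) -> P a \/ P b].

Definition noetherian : Prop := forall I : set R, ideal I -> @fin_gen R R^o I.
End Ideals.

Definition Ass (A : comPzRingType) (V : lmodType A) (N : set V) : set (set A) :=
  [set P | prime_ideal P /\ exists2 x, N x & P = ann x].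

(* V is the internal direct sum of the additive subgroups G i: every element
   has a unique finitely supported family of components. *)
Definition direct_sum (I : choiceType) (V : zmodType) (G : I -> set V) : Prop :=
  (forall i, GRing.zmod_closed (mem (G i))) /\
  (forall x : V, exists! c : I -> V,
     [/\ forall i, G i (c i), finite_set [set i | c i != 0]
       & x = \sum_(i \in [set: I]) c i]).

Definition multinat (d : nat) := {ffun 'I_d -> nat}.
Definition multideg (d : nat) := {ffun 'I_d -> int}.

Definition multideg_le d (m n : multideg d) : Prop := forall i, m i <= n i.

(* R is a Noetherian standard N^d-graded A-algebra with components G n; the
   degree 0 component is identified with A through the injection iota. *)
Record standard_multigraded (d : nat) (A R : comPzRingType)
    (iota : {rmorphism A -> R}) (G : multinat d -> set R) : Prop := {
  smg_noetherian : noetherian R;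
  smg_direct : direct_sum G;
  smg_mul : forall (m n : multinat d) x y,
    G m x -> G n y -> G [ffun i => (m i + n i)%N] (x * y);
  smg_inj : injective iota;
  smg_deg0 : G [ffun => 0%N] = range iota;
  smg_gen :
    smallest (fun S : set R => GRing.subring_closed (mem S))
      (range iota `|`
       \bigcup_(n in [set n : multinat d | (\sum_(i < d) n i)%N = 1%N]) G n)
    = setT }.

(* M need not be finitely generated over R. *)
Record multigraded_module (d : nat) (A R : comPzRingType)
    (iota : {rmorphism A -> R}) (G : multinat d -> set R)
    (M : lmodType R) (Mn : multideg d -> set M) : Prop := {
  mgm_direct : direct_sum Mn;
  mgm_scale : forall (m : multinat d) (n : multideg d) r x,
    G m r -> Mn n x -> Mn [ffun i => (m i)%:Z + n i] (r *: x);
  mgm_fg : forall n, @fin_gen A (restr_scalars iota M) (Mn n);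
  mgm_bounded : exists a, forall n, multideg_le n a -> Mn n = [set 0] }.

(* R_+ *)
Definition irrelevant d (R : comPzRingType) (G : multinat d -> set R) : set R :=
  ideal_gen (G [ffun => 1%N]).

Section Torsion.
Variables (R : comPzRingType) (M : lmodType R) (I : set R).

(* (0 :_M I) *)
Definition colon0 : set M := [set x | forall r, I r -> r *: x = 0].

(* H^0_I(M) *)
Definition H0 : set M :=
  [set x | exists2 t, (1 <= t)%N & forall r, ideal_exp I t r -> r *: x = 0].
End Torsion.

Arguments colon0 {R} M I.
Arguments H0 {R} M I.

(* Main.v *)
(* Let P = ann(x) be an associated prime of M_n, with x in M_n. Since R is
   Noetherian, for each multidegree m either some element of R_m x still has
   annihilator P, or a multiple sx with s outside P (which also has annihilator
   P) is killed by R_m. Applied repeatedly with m = (1,...,1) to a torsion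
   element x, this leads to an element of L' with annihilator P in a larger
   degree, so under (i) Ass(L_n) = Ass(L'_k) for n >= k. Applied to arbitrary x
   and m, it shows that P belongs to Ass(L_n) or to Ass(M_n') for all n' >= n;
   finiteness of Ass(M) makes the degrees from which primes persist uniform. *)

Require Import Defs.
From mathcomp Require Import all_boot all_order all_algebra.
From mathcomp Require Import boolp classical_sets functions cardinality fsbigop.
From mathcomp Require Import finmap zify.

Set Implicit Arguments.
Unset Strict Implicit.
Unset Printing Implicit Defensive.

Import Order.TTheory GRing.Theory Num.Theory.
Local Open Scope classical_set_scope.
Local Open Scope ring_scope.

(** Serves two directed families: scalars outside a prime, combined by products, and multidegrees,
    combined by upper bounds. *)
Lemma finite_directed_bound (T U : Type) (F : set T) (D : set U)
    (Q : T -> U -> Prop) :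
  finite_set F -> D !=set0 ->
  (forall u v, D u -> D v ->
     exists2 w, D w & forall x, Q x u \/ Q x v -> Q x w) ->
  (forall x, F x -> exists2 u, D u & Q x u) ->
  exists2 u, D u & forall x, F x -> Q x u.
Proof.
elim/Pchoice: T => T in F Q * => /finite_seqP[s ->] [u0 Du0] dirQ.
elim: s => [|x s IHs] exQ; first by exists u0.
have [u Du Qu] := exQ x (mem_head x s).
have [y sy|v Dv Qv] := IHs; first by apply: exQ; rewrite /= inE sy orbT.
have [w Dw Qw] := dirQ u v Du Dv; exists w => // y /=.
by rewrite inE => /predU1P[->|sy]; apply: Qw; [left | right; apply: Qv].
Qed.

(** * Submodules and ideals *)

Lemma submoduleP (R : pzRingType) (V : lmodType R) (N : set V) :
  submodule N <-> N 0 /\ forall a u v, N u -> N v -> N (a *: u + v).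
Proof.
split=> -[N0 Nlin]; split=> [|a u v]; try by move: N0; rewrite ?in_setE ?inE.
  by move=> Nu Nv; have := Nlin a u v (mem_set Nu) (mem_set Nv); rewrite in_setE.
by rewrite !in_setE; apply: Nlin.
Qed.

Lemma submodule_gen_submodule (R : pzRingType) (V : lmodType R) (S : set V) :
  submodule (submodule_gen S).
Proof.
apply/submoduleP; split=> [N [/submoduleP[N0 _] _] // | a u v Su Sv N NP].
by case: (NP) => /submoduleP[_ Nlin] _; apply: Nlin; [apply: Su | apply: Sv].
Qed.

Lemma submodule_genW (R : pzRingType) (V : lmodType R) (S : set V) :
  S `<=` submodule_gen S.
Proof. exact: sub_gen_smallest. Qed.

Lemma submodule_gen_sub (R : pzRingType) (V : lmodType R) (S N : set V) :
  submodule N -> S `<=` N -> submodule_gen S `<=` N.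
Proof. exact: smallest_sub. Qed.

Section IdealTheory.
Variable R : comPzRingType.
Implicit Types (I S T U P : set R).

Lemma idealP I : ideal I <-> I 0 /\ forall a u v, I u -> I v -> I (a * u + v).
Proof. exact: (@submoduleP R R^o). Qed.

Lemma ideal_gen_ideal S : ideal (ideal_gen S).
Proof. exact: submodule_gen_submodule. Qed.

Lemma ideal_genW S : S `<=` ideal_gen S.
Proof. exact: (@submodule_genW R R^o). Qed.

Lemma ideal_gen_sub S I : ideal I -> S `<=` I -> ideal_gen S `<=` I.
Proof. exact: (@submodule_gen_sub R R^o). Qed.

Lemma idealMr I a u : ideal I -> I u -> I (a * u).
Proof.
by move=> /idealP[I0 Ilin] Iu; rewrite -[_ * _]addr0; apply: Ilin.
Qed.

Lemma idealB I u v : ideal I -> I u -> I v -> I (u - v).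
Proof.
by move=> /idealP[I0 Ilin] Iu Iv; rewrite addrC -mulN1r; apply: Ilin.
Qed.

(** The elements whose products with a fixed set lie in [ideal_gen U] form an ideal. This reduces
    first [x] to a generator in [S], then, with that generator fixed, [y] to one in [T]. *)
Lemma ideal_gen_mul S T U x y :
  (forall s t, S s -> T t -> ideal_gen U (s * t)) ->
  ideal_gen S x -> ideal_gen T y -> ideal_gen U (x * y).
Proof.
have /idealP[U0 Ulin] := ideal_gen_ideal U; move=> STU Sx Ty.
have idl (Q : set R) : ideal [set s | forall t, Q t -> ideal_gen U (s * t)].
  apply/idealP; split=> [t _|a u v Hu Hv t Qt]; first by rewrite mul0r.
  by rewrite mulrDl -mulrA; apply: Ulin; [apply: Hu | apply: Hv].
apply: (ideal_gen_sub (idl (ideal_gen T))) Sx y Ty => s Ss t Tt.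
rewrite mulrC; suff Ht : T `<=` [set t | forall r, [set s] r ->
    ideal_gen U (t * r)].
  exact: (ideal_gen_sub (idl [set s]) Ht Tt s erefl).
by move=> t' Tt' _ ->; rewrite mulrC; apply: STU.
Qed.

Lemma ideal_mul_mem I J x y : I x -> J y -> ideal_mul I J (x * y).
Proof. by move=> Ix Jy; apply: ideal_genW; exists x => //; exists y. Qed.

Lemma ann_ideal (M : lmodType R) (x : M) : ideal (ann x).
Proof.
apply/idealP; split=> [|a u v]; rewrite /ann /=; first by rewrite scale0r.
by move=> ux vx; rewrite scalerDl -scalerA ux vx scaler0 addr0.
Qed.

Lemma noetherian_fin_gen S : noetherian R ->
  exists2 F : set R, finite_set F & ideal_gen S = ideal_gen F.
Proof. by move=> /(_ _ (ideal_gen_ideal S)). Qed.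

End IdealTheory.

(** * Homogeneous components *)

Lemma direct_sum_proj (I : choiceType) (V : zmodType) (G : I -> set V) :
  direct_sum G ->
  exists p : I -> V -> V,
    [/\ forall i x, G i (p i x),
        forall i x y, p i (x - y) = p i x - p i y,
        forall i j x, G i x -> p j x = if j == i then x else 0
      & forall x, exists s : seq I, x = \sum_(i <- s) p i x].
Proof.
case=> Gz dsum.
have G0 i : G i 0 by have [+ _] := Gz i; rewrite in_setE.
have GB i x y : G i x -> G i y -> G i (x - y).
  by move=> Gx Gy; have [_ /(_ x y)] := Gz i; rewrite !in_setE; apply.
(* Supports become duplicate-free lists, which may be larger than the support, so that two of them
   can be merged. By uniqueness ([cU]), each identity between projections follows by exhibiting a
   decomposition. *)
pose decomposes x (c : I -> V) := (forall i, G i (c i)) /\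
  exists2 s : seq I, uniq s & x = \sum_(i <- s) c i /\
    forall i, i \notin s -> c i = 0.
have fsumE (s : seq I) (c : I -> V) : uniq s ->
    (forall i, i \notin s -> c i = 0) ->
    \sum_(i \in [set: I]) c i = \sum_(i <- s) c i.
  move=> us c0; rewrite (fsbigE s) //; last by move=> i _; apply: c0.
  by apply: eq_bigl => i; rewrite in_setT.
have /choice[c cP] : forall x, exists c, decomposes x c.
  move=> x; have [c [[Gc finc ->] _]] := dsum x; exists c; split=> //.
  have c0 i : i \notin fset_set [set i | c i != 0] -> c i = 0.
    by rewrite in_fset_set // => /negP; rewrite in_setE /= => /negP/negbNE/eqP.
  exists (fset_set [set i | c i != 0]); first exact: fset_uniq.
  by split=> //; apply: fsumE.
have cU x c' : decomposes x c' -> c x = c'.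
  have [c0 [_ c0U]] := dsum x.
  suff U c1 : decomposes x c1 -> c0 = c1 by move=> /U c0c'; rewrite -(U _ (cP x)).
  case=> [Gc1 [s us [xE c10]]]; apply: c0U; split=> //; last by rewrite (fsumE s).
  apply: sub_finite_set (finite_seq s) => i /=; apply: contraNT.
  by move=> /c10 ->; rewrite eqxx.
exists (fun i x => c x i); split=> [i x|i x y|i j x Gx|x].
- by case: (cP x).
- rewrite (cU _ (fun i => c x i - c y i)) //.
  have [Gx [s us [xE x0]]] := cP x; have [Gy [t ut [yE y0]]] := cP y.
  split=> [k|]; first exact: GB.
  have st0 k : k \notin undup (s ++ t) -> k \notin s /\ k \notin t.
    by rewrite mem_undup mem_cat negb_or => /andP.
  exists (undup (s ++ t)); first exact: undup_uniq.
  split=> [|k /st0[/x0 -> /y0 ->]]; last by rewrite subrr.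
  rewrite sumrB -!(fsumE (undup (s ++ t))) ?undup_uniq //.
  + by rewrite (fsumE s _ us x0) (fsumE t _ ut y0) -xE -yE.
  + by move=> k /st0[_ /y0].
  + by move=> k /st0[/x0].
- rewrite (cU _ (fun j => if j == i then x else 0)) //; split.
    by move=> k; case: eqP => [->|].
  exists [:: i] => //; split; first by rewrite big_seq1 eqxx.
  by move=> k; rewrite inE => /negbTE ->.
- by have [_ [s _ [xE _]]] := cP x; exists s.
Qed.

(** * Ideals generated by components of a standard graded ring *)

Section StandardGraded.
Variables (d : nat) (A R : comPzRingType) (iota : {rmorphism A -> R}).
Variable G : multinat d -> set R.
Hypothesis Gstd : standard_multigraded iota G.
Implicit Types m n : multinat d.

Lemma smg_component0 m : G m 0.
Proof. by have [/(_ m)[+ _] _] := smg_direct Gstd; rewrite in_setE. Qed.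

Lemma smg_componentB m x y : G m x -> G m y -> G m (x - y).
Proof.
have [Gz _] := smg_direct Gstd; have [_ GB] := Gz m.
by move=> Gx Gy; have := GB x y; rewrite !in_setE; apply.
Qed.

(* The elements all of whose components satisfy the claim form a subring
   containing the generators of R. *)
Lemma component_sub_ideal m n :
  (forall i, m i <= n i)%N -> G n `<=` ideal_gen (G m).
Proof.
have [p [Gp pB pG pS]] := direct_sum_proj (smg_direct Gstd).
(* The claim is required for all smaller degrees at once: this is what makes it stable under
   products. *)
pose good n : set R := [set x | G n x /\
  forall m, (forall i, m i <= n i)%N -> ideal_gen (G m) x].
have good0 n' : good n' 0.
  split=> [|m' _]; first exact: smg_component0.
  by have /idealP[] := ideal_gen_ideal (G m').
have goodB n' x y : good n' x -> good n' y -> good n' (x - y).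
  move=> [Gx mx] [Gy my]; split; first exact: smg_componentB.
  by move=> m' mn; exact: idealB (ideal_gen_ideal _) (mx _ mn) (my _ mn).
have goodM n1 n2 x y : good n1 x -> good n2 y ->
    good [ffun i => (n1 i + n2 i)%N] (x * y).
  move=> [Gx mx] [Gy my]; split=> [|m' mn]; first exact: (smg_mul Gstd).
  (* A degree below [n1 + n2] splits into parts below [n1] and [n2]: the first takes as much as [n1]
     allows. *)
  pose m1 : multinat d := [ffun i => minn (m' i) (n1 i)].
  pose m2 : multinat d := [ffun i => (m' i - m1 i)%N].
  apply: (@ideal_gen_mul _ (G m1) (G m2)).
  - move=> s t Gs Gt; apply: ideal_genW.
    have -> : m' = [ffun i => (m1 i + m2 i)%N].
      by apply/ffunP => i; rewrite !ffunE subnKC // geq_minl.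
    exact: (smg_mul Gstd).
  - by apply: mx => i; rewrite ffunE geq_minr.
  - apply: my => i; move: (mn i); rewrite !ffunE => mni.
    by rewrite minnE subKn ?leq_subr //; lia.
pose S : set R := [set x | forall n, good n (p n x)].
have goodS n' x : good n' x -> S x.
  by move=> gx k; case: (gx) => Gx _; rewrite (pG _ _ _ Gx); case: eqP => [->|].
have S0 : S 0 by apply: (goodS n).
have SB x y : S x -> S y -> S (x - y) by move=> Sx Sy k; rewrite pB; apply: goodB.
have SD x y : S x -> S y -> S (x + y).
  by move=> Sx Sy; rewrite -[y]opprK; apply: (SB) => //; rewrite -sub0r; apply: SB.
have good_iota a : good [ffun => 0%N] (iota a).
  split=> [|m' m0]; first by rewrite (smg_deg0 Gstd); exists a.
  have -> : m' = [ffun => 0%N].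
    by apply/ffunP => i; apply/eqP; move: (m0 i); rewrite !ffunE leqn0.
  by apply: ideal_genW; rewrite (smg_deg0 Gstd); exists a.
have ST : S = setT.
  rewrite -subTset -(smg_gen Gstd); apply: smallest_sub; first split.
  - by rewrite in_setE -(rmorph1 iota); apply: goodS (good_iota 1).
  - by move=> x y; rewrite !in_setE; apply: SB.
  - move=> x y; rewrite !in_setE => Sx Sy.
    have [s ->] := pS x; have [t ->] := pS y; rewrite mulr_suml.
    apply: (big_ind S) => // i _; rewrite mulr_sumr; apply: (big_ind S) => // j _.
    by apply: goodS; apply: goodM.
  - move=> x [[a _ <-]|[n' /= n'1 Gx]]; first exact: goodS (good_iota a).
    apply: (goodS n'); split=> // m' mn.
    (* A degree below one of total degree one is either that degree or zero, and the component of
       degree zero contains 1, hence generates the unit ideal. *)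
    have [->|/eqP m'n'] := eqVneq m' n'; first exact: ideal_genW.
    suff -> : m' = [ffun => 0%N].
      rewrite -[x]mulr1; apply: (idealMr x (ideal_gen_ideal _)).
      apply: ideal_genW; rewrite (smg_deg0 Gstd).
      by exists 1; rewrite ?rmorph1.
    have m'S : (\sum_i m' i < 1)%N.
      rewrite ltnNge; apply: contra_notN m'n' => m'1; apply/ffunP => i.
      have := geq_leqif (@leqif_sum _ xpredT _ _ _ (fun i _ => leqif_eq (mn i))).
      by rewrite n'1 m'1 => /esym/forallP/(_ i)/eqP.
    apply/ffunP => i; rewrite ffunE; apply/eqP; rewrite -leqn0.
    by move: m'S; rewrite ltnS (bigD1 i) //=; apply: leq_trans; apply: leq_addr.
move=> mn x Gx; have : S x by rewrite ST.
by move=> /(_ n); rewrite (pG _ _ _ Gx) eqxx => -[_]; apply.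
Qed.

(** With [component_sub_ideal], this shows that an element killed by a single component [G m] is
    torsion: take [t] above every coordinate of [m]. *)
Lemma irrelevant_exp_sub t :
  ideal_exp (irrelevant G) t `<=` ideal_gen (G [ffun => t]).
Proof.
elim: t => [|t IHt] x.
  move=> _; rewrite -[x]mulr1; apply: (idealMr x (ideal_gen_ideal _)).
  by apply: ideal_genW; rewrite (smg_deg0 Gstd); exists 1; rewrite ?rmorph1.
apply: (ideal_gen_sub (ideal_gen_ideal _)) => _ [y Iy [z /IHt Jz <-]].
apply: (@ideal_gen_mul _ (G [ffun => 1%N]) (G [ffun => t])) => // u v Gu Gv.
apply: ideal_genW; have -> : [ffun => t.+1] =
    [ffun i => ([ffun => 1%N] i + [ffun => t] i)%N] :> multinat d.
  by apply/ffunP => i; rewrite !ffunE.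
exact: (smg_mul Gstd).
Qed.

End StandardGraded.

(** * Associated primes over the degree zero subring *)

Section AssociatedPrimes.
Variables (A R : comPzRingType) (iota : {rmorphism A -> R}) (M : lmodType R).
Implicit Types (N : set M) (P : set A) (S : set R) (x : M).

Local Notation AssA N := (@Ass A (restr_scalars iota M) N).

Lemma AssP N P : AssA N P <->
  prime_ideal P /\ exists2 x, N x & forall a, P a <-> iota a *: x = 0.
Proof.
split=> -[Pp [x Nx Px]]; split=> //; exists x => //; first by rewrite Px.
by apply/funext => a; apply/propext; apply: Px.
Qed.

Lemma AssS N N' : N `<=` N' -> AssA N `<=` AssA N'.
Proof. by move=> NN' P [Pp [x Nx Px]]; split=> //; exists x => //; apply: NN'. Qed.

(** By primality, [a * s] lies in [P] exactly when [a] does, so passing from [x] to [iota s *: x]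
    keeps the annihilator [P]. *)
Lemma Ass_scale N P x s : prime_ideal P ->
  (forall a, P a <-> iota a *: x = 0) -> ~ P s -> N (iota s *: x) -> AssA N P.
Proof.
move=> Pp Px Ps Nsx; apply/AssP; split=> //; exists (iota s *: x) => // a.
rewrite scalerA -rmorphM -Px; case: Pp => idP _ Pm.
by split=> [Pa|/Pm[]//]; rewrite mulrC; apply: idealMr.
Qed.

(* Since S generates a finitely generated ideal, a product of finitely many
   of the individual annihilators kills all of it. *)
Lemma noetherian_common_annihilator P S x : noetherian R -> prime_ideal P ->
  (forall r, S r -> exists2 s, ~ P s & iota s *: (r *: x) = 0) ->
  exists2 s, ~ P s & forall r, ideal_gen S r -> r *: (iota s *: x) = 0.
Proof.
move=> nR [idP P1 Pm] Sx; have [F finF SF] := noetherian_fin_gen S nR.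
have Pmul s t : ~ P s -> ~ P t -> ~ P (s * t) by move=> Ps Pt /Pm[].
(* The finite generating set [F] need not lie in [S]; the hypothesis reaches it because the elements
   that satisfy it form an ideal. *)
have Kid : ideal [set r | exists2 s, ~ P s & iota s *: (r *: x) = 0].
  apply/idealP; split=> [|a u v [s Ps su] [t Pt tv]].
    by exists 1 => //; rewrite scale0r scaler0.
  exists (s * t); first exact: Pmul.
  rewrite scalerDl scalerDr -scalerA rmorphM.
  rewrite -[_ *: (v *: x)]scalerA tv scaler0 addr0.
  rewrite [iota s * _]mulrC -scalerA [iota s *: _]scalerA [iota s * a]mulrC.
  by rewrite -scalerA su !scaler0.
have [s t Ps Pt|r Fr|s Ps sF] := @finite_directed_bound _ _ F [set s | ~ P s]
    (fun r s => iota s *: (r *: x) = 0) finF (ex_intro _ 1 P1).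
- exists (s * t); first exact: Pmul.
  move=> r; rewrite rmorphM => -[sr|tr]; last by rewrite -scalerA tr scaler0.
  by rewrite mulrC -scalerA sr scaler0.
- by apply: (ideal_gen_sub Kid Sx); rewrite SF; apply: ideal_genW.
exists s => // r; rewrite SF => Fr.
apply: (ideal_gen_sub (ann_ideal (iota s *: x))) Fr => t Ft.
by rewrite /ann /= scalerA mulrC -scalerA sF.
Qed.

(** The annihilator of every [r *: x] contains [P]. If it is never equal to [P] for [r] in [S], each
    one contains a scalar outside [P], and these combine into a single [s]. *)
Lemma Ass_dichotomy P S x : noetherian R -> prime_ideal P ->
  (forall a, P a <-> iota a *: x = 0) ->
  (exists2 r, S r & forall a, P a <-> iota a *: (r *: x) = 0) \/
  (exists2 s, ~ P s & forall r, ideal_gen S r -> r *: (iota s *: x) = 0).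
Proof.
move=> nR Pp Px; have [|nS] := pselect (exists2 r, S r &
  forall a, P a <-> iota a *: (r *: x) = 0); first by left.
right; apply: noetherian_common_annihilator => // r Sr.
apply: contrapT => nr; apply: nS; exists r => // a; split=> [/Px ax|arx].
  by rewrite scalerA mulrC -scalerA ax scaler0.
by apply: contrapT => Pa; apply: nr; exists a.
Qed.

End AssociatedPrimes.

(** * Associated primes of the components of a multigraded module *)

Section MultigradedModule.
Variables (d : nat) (A R : comPzRingType) (iota : {rmorphism A -> R}).
Variables (G : multinat d -> set R) (M : lmodType R) (Mn : multideg d -> set M).
Hypothesis (Gstd : standard_multigraded iota G).
Hypothesis (Mgr : multigraded_module iota G Mn).
Implicit Types (n k l : multideg d) (P : set A).

Local Notation AssA N := (@Ass A (restr_scalars iota M) N).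
Local Notation L := (H0 M (irrelevant G)).
Local Notation L' := (colon0 M (irrelevant G)).

Lemma mgm_iota n a x : Mn n x -> Mn n (iota a *: x).
Proof.
move=> Mx; have G0a : G [ffun => 0%N] (iota a).
  by rewrite (smg_deg0 Gstd); exists a.
have := mgm_scale Mgr G0a Mx; congr (Mn _ _).
by apply/ffunP => i; rewrite !ffunE add0r.
Qed.

Lemma colon0_sub_H0 (I : set R) : colon0 M I `<=` H0 M I.
Proof.
move=> x Ix; exists 1%N => // r.
apply: (ideal_gen_sub (ann_ideal x)) => _ [y Iy [z _ <-]].
by rewrite /ann /= mulrC -scalerA Ix // scaler0.
Qed.

(** Induction on the exponent killing [x]: multiplying by an element of degree (1,...,1) lowers it
    by one and raises the degree, unless a multiple by a scalar outside [P] already lies in [L']. *)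
Lemma Ass_H0_colon0 n P : AssA (L `&` Mn n) P ->
  exists2 k, multideg_le n k & AssA (L' `&` Mn k) P.
Proof.
move=> /AssP[Pp [x [[t _ tx] Mx] Px]]; elim: t => [|t IHt] in n x tx Mx Px *.
  (* The bound [1 <= t] was dropped so that the induction can start at the zeroth power [setT]:
     there [x = 0], which would put 1 in [P]. *)
  case: Pp => _ []; apply/Px; rewrite rmorph1 scale1r.
  by rewrite -[x]scale1r; apply: tx.
have [[r Gr rx]|[s Ps sx]] :=
    Ass_dichotomy (G [ffun => 1%N]) (smg_noetherian Gstd) Pp Px.
  have [|k le_k Pk] := IHt _ (r *: x) _ (mgm_scale Mgr Gr Mx) rx.
    move=> u Iu; rewrite scalerA mulrC; apply: tx.
    by apply: ideal_mul_mem => //; apply: ideal_genW.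
  exists k => // i; apply: le_trans (le_k i); rewrite !ffunE.
  by rewrite lerDr.
exists n; first by move=> i.
by apply: (Ass_scale Pp Px Ps); split=> //; apply: mgm_iota.
Qed.

Lemma Ass_H0_or_persistent n P : AssA (Mn n) P ->
  AssA (L `&` Mn n) P \/ forall k, multideg_le n k -> AssA (Mn k) P.
Proof.
move=> /AssP[Pp [x Mx Px]].
have [|nL] := pselect (AssA (L `&` Mn n) P); first by left.
(* Since [n] is below [k], the absolute value only converts the difference [k - n] to a natural
   multidegree. *)
right=> k le_nk; pose m : multinat d := [ffun i => `|k i - n i|%N].
have [[r Gr rx]|[s Ps sx]] :=
    Ass_dichotomy (G m) (smg_noetherian Gstd) Pp Px.
  apply/AssP; split=> //; exists (r *: x) => //.
  have := mgm_scale Mgr Gr Mx; congr (Mn _ _); apply/ffunP => i.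
  by rewrite !ffunE gez0_abs ?subr_ge0 ?le_nk // subrK.
case: nL; apply: (Ass_scale Pp Px Ps); split; last exact: mgm_iota.
(* The maximum dominates [m]; the successor ensures a positive exponent even when [m] is zero. *)
exists (\max_i m i)%N.+1 => // r /(irrelevant_exp_sub Gstd).
apply: (ideal_gen_sub (ann_ideal _)) => t Gt; apply: sx.
apply: (component_sub_ideal Gstd) Gt => i; rewrite [leqRHS]ffunE.
by apply: leqW; apply: (@leq_bigmax _ (fun i => m i)).
Qed.

Lemma multideg_ub k l :
  exists2 n, multideg_le k n & multideg_le l n.
Proof.
by exists [ffun i => Num.max (k i) (l i)] => i; rewrite ffunE le_max lexx ?orbT.
Qed.

Lemma multideg_le_trans k l n :
  multideg_le k l -> multideg_le l n -> multideg_le k n.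
Proof. by move=> kl ln i; apply: le_trans (ln i). Qed.

(** The same [k] works. [Ass_H0_colon0] gives no control over the degree it reaches, but that degree
    stays above [k], where (i) identifies all the sets for [L']. *)
Lemma Ass_H0_stable :
  (exists k, forall n, multideg_le k n ->
     AssA (L' `&` Mn n) = AssA (L' `&` Mn k)) ->
  exists l, forall n, multideg_le l n ->
     AssA (L `&` Mn n) = AssA (L `&` Mn l).
Proof.
move=> [k kP]; have AssL n : multideg_le k n ->
    AssA (L `&` Mn n) = AssA (L' `&` Mn k).
  move=> kn; apply/seteqP; split=> P.
    move=> /Ass_H0_colon0[n' nn']; rewrite kP //.
    exact: multideg_le_trans kn nn'.
  by rewrite -(kP n kn); apply: AssS; apply: setSI; apply: colon0_sub_H0.
by exists k => n kn; rewrite !AssL // => i.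
Qed.

Lemma Ass_component_stable : finite_set (AssA [set: M]) ->
  (exists l, forall n, multideg_le l n ->
     AssA (L `&` Mn n) = AssA (L `&` Mn l)) ->
  exists h, forall n, multideg_le h n -> AssA (Mn n) = AssA (Mn h).
Proof.
move=> finM [l lP].
pose persists P k := forall n, multideg_le k n -> AssA (Mn n) P.
(* Each prime in [F] may persist from a different degree; finiteness yields one degree [h0] valid
   for all of them. *)
pose F := [set P | AssA [set: M] P /\ exists k, persists P k].
have finF : finite_set F by apply: sub_finite_set finM => P [].
have [k k' _ _|P [_ [k Pk]]|h0 _ h0P] :=
    @finite_directed_bound _ _ F setT persists finF (ex_intro _ l I).
- have [n kn k'n] := multideg_ub k k'; exists n => // P.
  by case=> Pk n' nn'; apply: Pk; apply: multideg_le_trans nn'.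
- by exists k.
have [h h0h lh] := multideg_ub h0 l; exists h.
(* Here [n] and [n'] need not be comparable: a torsion prime is transported by (ii), while a prime
   persisting from [n] belongs to [F] and so already persists from [h0]. *)
suff sub n n' : multideg_le h n -> multideg_le h n' ->
    AssA (Mn n) `<=` AssA (Mn n').
  by move=> n hn; apply/seteqP; split; apply: sub => // i.
move=> hn hn' P PMn; have [PL|Pn] := Ass_H0_or_persistent PMn.
  have : AssA (L `&` Mn n') P.
    have ln := multideg_le_trans lh hn; have ln' := multideg_le_trans lh hn'.
    by rewrite lP // -(lP n).
  by apply: AssS; apply: subIsetr.
apply: h0P; last exact: multideg_le_trans hn'.
by split; [apply: AssS PMn | exists n].
Qed.

End MultigradedModule.

Theorem theorem4p4 (d : nat) (A R : comPzRingType) (iota : {rmorphism A -> R})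
    (G : multinat d -> set R) (M : lmodType R) (Mn : multideg d -> set M) :
  standard_multigraded iota G ->
  multigraded_module iota G Mn ->
  let AssA (N : set M) := @Ass A (restr_scalars iota M) N in
  let L : set M := H0 M (irrelevant G) in
  let L' : set M := colon0 M (irrelevant G) in
  finite_set (AssA [set: M]) ->
  let i := exists k : multideg d, forall n : multideg d,
    multideg_le k n -> AssA (L' `&` Mn n) = AssA (L' `&` Mn k) in
  let ii := exists l : multideg d, forall n : multideg d,
    multideg_le l n -> AssA (L `&` Mn n) = AssA (L `&` Mn l) in
  let iii := exists h : multideg d, forall n : multideg d,
    multideg_le h n -> AssA (Mn n) = AssA (Mn h) in
  (i -> ii) /\ (ii -> iii).
Proof.
move=> Gstd Mgr AssA L L' finM; split; first exact: Ass_H0_stable.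
exact: Ass_component_stable.
Qed.
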